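(* Let $\Gamma$ be a connected vertex-transitive digraph such that the in-valency and the out-valency are both $2$, and set $G=\mathrm{Aut}(\Gamma)$. If $\Gamma$ is not highly-arc-transitive, then there is a non-negative integer $k$ such that $G$ acts regularly on the $k$-arcs of $\Gamma$ and $|G_v|=2^k$ for every vertex $v$ of $\Gamma$. In particular, if the vertex stabilizers in $\mathrm{Aut}(\Gamma)$ are infinite, then $\Gamma$ is highly-arc-transitive.
   Context: A digraph $\Gamma=(V\Gamma,E\Gamma)$ has vertex set $V\Gamma$ and arc set $E\Gamma\subseteq V\Gamma\times V\Gamma$. It is connected if its underlying undirected graph is connected. The in-valency (out-valency) of a vertex $v$ is the number of vertices $u$ with $(u,v)\in E\Gamma$ (respectively $(v,u)\in E\Gamma$). A $k$-arc is a sequence of vertices $v_0,\dots,v_k$ with $(v_i,v_{i+1})\in E\Gamma$ for $0\le i<k$ (a 0-arc is a vertex). $\Gamma$ is vertex-transitive if $\mathrm{Aut}(\Gamma)$ is transitive on vertices, $k$-arc-transitive if $\mathrm{Aut}(\Gamma)$ is transitive on $k$-arcs, and highly-arc-transitive if it is $k$-arc-transitive for all $k$. A group acts regularly on a set if it acts transitively and the stabilizer of each point is trivial. $G_v$ is the stabilizer of $v$ in $G$. *)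

(* Defs.v *)
From mathcomp Require Import all_boot.
From mathcomp Require Import boolp classical_sets functions cardinality.
From Stdlib Require Import Relation_Operators.

Set Implicit Arguments.
Unset Strict Implicit.
Unset Printing Implicit Defensive.

Local Open Scope classical_set_scope.

(* Loops, 2-cycles and infinite vertex sets are allowed. *)
Record digraph := Digraph {
  vertex :> Type;
  arc : vertex -> vertex -> Prop
}.

Definition digraph_connected (Gamma : digraph) : Prop :=
  forall u v : Gamma,
    clos_refl_trans Gamma (fun x y => arc x y \/ arc y x) u v.

Definition in_nbhd (Gamma : digraph) (v : Gamma) : set Gamma :=
  [set u | arc u v].

Definition out_nbhd (Gamma : digraph) (v : Gamma) : set Gamma :=
  [set u | arc v u].

(* A k-arc is a family of k + 1 vertices v_0, ..., v_k; for i : 'I_k, the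
   indices [widen_ord (leqnSn k) i] and [lift ord0 i] are i and i + 1. *)
Definition karcs (Gamma : digraph) (k : nat) : set ('I_k.+1 -> Gamma) :=
  [set a | forall i : 'I_k, arc (a (widen_ord (leqnSn k) i)) (a (lift ord0 i))].
Arguments karcs : clear implicits.

Definition Aut (Gamma : digraph) : set (Gamma -> Gamma) :=
  [set g | bijective g /\ forall u v, arc (g u) (g v) <-> arc u v].
Arguments Aut : clear implicits.

(* Permutation groups are sets of self-maps of V; in the next three definitions
   [act] is the action of these maps on another type X, and A is the subset of
   X that is acted upon. *)
Definition transitive_on (V X : Type) (G : set (V -> V))
    (act : (V -> V) -> X -> X) (A : set X) : Prop :=
  forall x y, A x -> A y -> exists2 g, G g & act g x = y.

Definition stabilizer (V X : Type) (G : set (V -> V))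
    (act : (V -> V) -> X -> X) (x : X) : set (V -> V) :=
  [set g | G g /\ act g x = x].

Definition regular_on (V X : Type) (G : set (V -> V))
    (act : (V -> V) -> X -> X) (A : set X) : Prop :=
  transitive_on G act A /\ forall x, A x -> stabilizer G act x = [set id].

Definition act_vertex (V : Type) (g : V -> V) (v : V) : V := g v.

Definition act_karc (V : Type) (k : nat) (g : V -> V) (a : 'I_k.+1 -> V) :
  'I_k.+1 -> V := g \o a.

Definition vertex_stabilizer (Gamma : digraph) (v : Gamma) :
    set (Gamma -> Gamma) :=
  stabilizer (Aut Gamma) (@act_vertex Gamma) v.

Definition vertex_transitive (Gamma : digraph) : Prop :=
  transitive_on (Aut Gamma) (@act_vertex Gamma) setT.

Definition karc_transitive (Gamma : digraph) (k : nat) : Prop :=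
  transitive_on (Aut Gamma) (@act_karc Gamma k) (karcs Gamma k).

Definition highly_arc_transitive (Gamma : digraph) : Prop :=
  forall k, karc_transitive Gamma k.

Definition karc_regular (Gamma : digraph) (k : nat) : Prop :=
  regular_on (Aut Gamma) (@act_karc Gamma k) (karcs Gamma k).

(* Main.v *)
Require Import Defs.
From mathcomp Require Import all_boot.
From mathcomp Require Import boolp classical_sets functions cardinality.

Local Open Scope classical_set_scope.
Local Open Scope card_scope.

(** Let k be the largest integer such that Gamma is k-arc-transitive. If an
automorphism fixing a k-arc moved the out-neighbours of its last vertex, it
would swap the two of them and Gamma would be (k+1)-arc-transitive; hence an
automorphism fixing a k-arc fixes every k-arc obtained by shifting it one step
forwards, and dually backwards. By connectedness such an automorphism is
trivial, so G is regular on k-arcs and G_v is regular on the 2^k k-arcs starting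
at v. *)

Lemma Aut_comp (Gamma : digraph) (g h : Gamma -> Gamma) :
  Aut Gamma g -> Aut Gamma h -> Aut Gamma (g \o h).
Proof.
move=> [bg Eg] [bh Eh]; split; first exact: bij_comp.
by move=> u v; rewrite /= Eg.
Qed.

Lemma Aut_inv (Gamma : digraph) (g : Gamma -> Gamma) :
  Aut Gamma g -> exists2 h, Aut Gamma h & cancel g h /\ cancel h g.
Proof.
move=> [[h gK hK] Eg]; exists h => //; split; first by exists g.
by move=> u v; rewrite -Eg !hK.
Qed.

Lemma Aut_id (Gamma : digraph) : Aut Gamma id.
Proof. by split=> //; exists id. Qed.

(* The values of p beyond k are junk; they spare the casts of ordinals. *)
Definition walk (Gamma : digraph) (k : nat) (p : nat -> Gamma) : Prop :=
  forall i, i < k -> Defs.arc (p i) (p i.+1).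

Definition walk_transitive (Gamma : digraph) (k : nat) : Prop :=
  forall p q : nat -> Gamma, walk Gamma k p -> walk Gamma k q ->
  exists2 g, Aut Gamma g & forall i, i <= k -> g (p i) = q i.

Lemma karcs_walk (Gamma : digraph) (k : nat) (p : nat -> Gamma) :
  walk Gamma k p -> karcs Gamma k (fun i : 'I_k.+1 => p i).
Proof. by move=> pw i; have := pw i (ltn_ord i); rewrite -lift0. Qed.

Lemma walk_karcs (Gamma : digraph) (k : nat) (a : 'I_k.+1 -> Gamma) :
  karcs Gamma k a -> walk Gamma k (fun i => a (inord i)).
Proof.
move=> aw i lt_ik; have := aw (Ordinal lt_ik).
by congr (Defs.arc (a _) (a _)); apply/val_inj; rewrite /= inordK // ltnS ltnW.
Qed.

Lemma karc_transitiveP (Gamma : digraph) (k : nat) :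
  karc_transitive Gamma k <-> walk_transitive Gamma k.
Proof.
split=> tr p q pw qw.
- have [g Gg /(congr1 (@^~ _)) gE] :=
    tr _ _ (karcs_walk _ _ _ pw) (karcs_walk _ _ _ qw).
  by exists g => // i le_ik; have := gE (Ordinal (le_ik : i < k.+1)).
- have [g Gg gE] := tr _ _ (walk_karcs _ _ _ pw) (walk_karcs _ _ _ qw).
  exists g => //; apply/funext => i; have := gE i.
  by rewrite inord_val; apply; rewrite -ltnS.
Qed.

Definition reverse (Gamma : digraph) : digraph :=
  Digraph (fun u v : Gamma => Defs.arc v u).

Lemma Aut_reverse (Gamma : digraph) (g : Gamma -> Gamma) :
  Aut (reverse Gamma) g <-> Aut Gamma g.
Proof. by split=> -[bg Eg]; split=> // u v; exact: Eg. Qed.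

Lemma walk_reverse (Gamma : digraph) (k : nat) (p : nat -> Gamma) :
  walk Gamma k p -> walk (reverse Gamma) k (fun i => p (k - i)).
Proof.
move=> pw i lt_ik; rewrite /Defs.arc /= -(subnSK lt_ik); apply: pw.
by rewrite subnSK // leq_subr.
Qed.

Lemma walk_transitive_reverse (Gamma : digraph) (k : nat) :
  walk_transitive Gamma k -> walk_transitive (reverse Gamma) k.
Proof.
move=> tr p q pw qw.
have [g Gg gE] := tr _ _ (walk_reverse _ _ _ pw) (walk_reverse _ _ _ qw).
exists g; first exact/Aut_reverse.
by move=> i le_ik; have := gE _ (leq_subr i k); rewrite subKn.
Qed.

(** Boolean labels turn arguments about two neighbours into case analysis, and later let bit strings
    encode walks. *)
Lemma card_eq2_coding (T : Type) (A : set T) :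
  A #= `I_2 -> exists s : bool -> T, injective s /\ A = range s.
Proof.
move=> /card_set_bijP[f [f_fun f_inj f_surj]].
have [a Aa fa] := f_surj 0 isT; have [b Ab fb] := f_surj 1 isT.
exists (fun c => if c then b else a); split.
  by move=> [] [] // ab; move: fa; rewrite ?ab ?fb // -ab fb.
apply/seteqP; split=> [x Ax|_ [[] _ <-] //].
have := f_fun x Ax; rewrite /=; case E: (f x) => [|[|//]] _.
- by exists false => //; apply: f_inj; rewrite ?inE // E.
- by exists true => //; apply: f_inj; rewrite ?inE // E.
Qed.

Lemma card_eq2_third (T : Type) (A : set T) (x y z : T) :
  A #= `I_2 -> A x -> A y -> A z -> x <> z -> y <> z -> x = y.
Proof.
move=> /card_eq2_coding[s [_ ->]] [a _ <-] [b _ <-] [c _ <-].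
by case: a b c => [] [] [].
Qed.

Lemma card_fintype (T : finType) : [set: T] #= `I_#|T|.
Proof.
have <- : (fun x : T => val (enum_rank x)) @` setT = `I_#|T|.
  apply/seteqP; split=> [_ [x _ <-]|i lt_i]; first exact: ltn_ord.
  by exists (enum_val (Ordinal lt_i)); rewrite //= enum_valK.
by apply/card_esym/inj_card_eq => x y _ _ /val_inj/enum_rank_inj.
Qed.

(** Given two (k+1)-arcs, k-arc-transitivity carries the first k+1 vertices of each onto those of
    [p]. Their last vertices then lie among the two out-neighbours of [p k]; if they differ, a [g]
    that moves [p k.+1] exchanges them. *)
Lemma next_vertex_fixed (Gamma : digraph) (k : nat) :
  (forall v : Gamma, out_nbhd v #= `I_2) ->
  walk_transitive Gamma k -> ~ walk_transitive Gamma k.+1 ->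
  forall p g, Aut Gamma g -> walk Gamma k.+1 p ->
  (forall i, i <= k -> g (p i) = p i) -> g (p k.+1) = p k.+1.
Proof.
move=> out2 tr ntr p g Gg pw gp; apply: contrapT => g_moves; apply: ntr.
have Gout h : Aut Gamma h -> forall q, walk Gamma k.+1 q -> h (q k) = p k ->
    out_nbhd (p k) (h (q k.+1)).
  by move=> [_ Eh] q qw hq; rewrite /out_nbhd /= -hq Eh; exact: qw.
have third x y z := card_eq2_third _ _ x y z (out2 (p k)).
have p_out : out_nbhd (p k) (p k.+1) by exact: pw.
have gN w : out_nbhd (p k) w -> out_nbhd (p k) (g w).
  by move=> Nw; rewrite /out_nbhd /= -{1}(gp k (leqnn k)); apply/(Gg.2 _ _).
have g_inj : injective g by exact: bij_inj Gg.1.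
move=> x y xw yw.
have walkW q : walk Gamma k.+1 q -> walk Gamma k q.
  by move=> qw i lt_ik; apply: qw; exact: ltnW.
have [h1 Gh1 h1E] := tr _ _ (walkW _ xw) (walkW _ pw).
have [h2 Gh2 h2E] := tr _ _ (walkW _ yw) (walkW _ pw).
have Nu := Gout _ Gh1 _ xw (h1E _ (leqnn k)).
have Nw := Gout _ Gh2 _ yw (h2E _ (leqnn k)).
have [h2' Gh2' [h2K _]] := Aut_inv _ _ Gh2.
have [uw|u_w] := pselect (h1 (x k.+1) = h2 (y k.+1)).
- exists (h2' \o h1); first exact: Aut_comp.
  move=> i; rewrite leq_eqVlt => /predU1P[->|]; first by rewrite /= uw h2K.
  by rewrite ltnS => le_ik; rewrite /= h1E // -h2E // h2K.
exists (h2' \o (g \o h1)); first by do 2!apply: Aut_comp => //.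
move=> i; rewrite leq_eqVlt => /predU1P[->|]; last first.
  by rewrite ltnS => le_ik; rewrite /= h1E // gp // -h2E // h2K.
rewrite /=; set u := h1 _ in Nu u_w *; set w := h2 _ in Nw u_w.
suff -> : g u = w by rewrite h2K.
apply: (third _ _ u) => //; [exact: gN| |exact: nesym].
(* If [g] fixed [u], then [u] and [g (p k.+1)] would both be the out-neighbour of [p k] other than
   [p k.+1], against injectivity of [g]. *)
move=> gu; have pu : u <> p k.+1 by move=> E; rewrite E in gu.
apply: (pu); apply: g_inj; rewrite gu.
by apply: (third _ _ (p k.+1)) => //; exact: gN.
Qed.

(* Fixing a k-arc ending at v propagates forwards from v; the dual notion in the
   reverse digraph propagates backwards, and both notions agree. *)
Definition fixes_walk_to (Gamma : digraph) (k : nat) (g : Gamma -> Gamma)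
    (v : Gamma) : Prop :=
  exists p, [/\ walk Gamma k p, p k = v & forall i, i <= k -> g (p i) = p i].

Section Propagation.
Variables (Gamma : digraph) (k : nat) (g : Gamma -> Gamma).
Hypotheses (out2 : forall v : Gamma, out_nbhd v #= `I_2).
Hypotheses (tr : walk_transitive Gamma k) (ntr : ~ walk_transitive Gamma k.+1).
Hypothesis (Gg : Aut Gamma g).

(** Append [w] to the fixed walk, apply [next_vertex_fixed], and drop the first vertex. *)
Lemma fixes_walk_to_out (v w : Gamma) :
  Defs.arc v w -> fixes_walk_to Gamma k g v -> fixes_walk_to Gamma k g w.
Proof.
move=> vw [p [pw pk gp]]; pose q i := if i <= k then p i else w.
have qw : walk Gamma k.+1 q.
  move=> i; rewrite ltnS /q => le_ik; rewrite le_ik.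
  case: ltnP => [|le_ki]; first exact: pw.
  by have -> : i = k; [apply/eqP; rewrite eqn_leq le_ik | rewrite pk].
have gq i : i <= k -> g (q i) = q i by move=> le_ik; rewrite /q le_ik gp.
exists (fun i => q i.+1); split.
- by move=> i lt_ik; exact: qw.
- by rewrite /q ltnn.
move=> i; rewrite leq_eqVlt => /predU1P[->|]; last exact: gq.
exact: (next_vertex_fixed _ _ out2 tr ntr).
Qed.

(** A walk to [v] in the reverse digraph is a walk of [Gamma] starting at [v]. Any choice of
    successive out-neighbours gives one, and forward propagation shows that [g] fixes all its
    vertices. *)
Lemma fixes_walk_to_reverse (v : Gamma) :
  fixes_walk_to Gamma k g v -> fixes_walk_to (reverse Gamma) k g v.
Proof.
move=> gv; have out1 (x : Gamma) : exists y, Defs.arc x y.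
  have [s [_ /seteqP[_ sN]]] := card_eq2_coding _ _ (out2 x).
  by exists (s true); apply: sN; exists true.
have [next nextP] := choice out1.
have walk_on i : fixes_walk_to Gamma k g (iter i next v).
  by elim: i => //= i; apply: fixes_walk_to_out; exact: nextP.
exists (fun i => iter (k - i) next v); split; last 2 first.
- by rewrite subnn.
- by move=> i _; have [p [_ <- ->]] := walk_on (k - i).
by apply: walk_reverse (fun i => iter i next v) _ => i _; exact: nextP.
Qed.

End Propagation.

Lemma fixed_walk_id (Gamma : digraph) (k : nat) :
  digraph_connected Gamma ->
  (forall v : Gamma, in_nbhd v #= `I_2) ->
  (forall v : Gamma, out_nbhd v #= `I_2) ->
  walk_transitive Gamma k -> ~ walk_transitive Gamma k.+1 ->
  forall p g, Aut Gamma g -> walk Gamma k p ->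
  (forall i, i <= k -> g (p i) = p i) -> g = id.
Proof.
move=> conn in2 out2 tr ntr p g Gg pw gp.
have Gg' : Aut (reverse Gamma) g by exact/Aut_reverse.
have tr' := walk_transitive_reverse _ _ tr.
(* Reversing twice restores the arcs up to conversion, so each lemma on [reverse] also serves in the
   opposite direction. *)
have ntr' : ~ walk_transitive (reverse Gamma) k.+1.
  by move=> /walk_transitive_reverse.
have fwd := fixes_walk_to_out _ _ _ out2 tr ntr Gg.
have bwd := fixes_walk_to_out (reverse Gamma) _ _ in2 tr' ntr' Gg'.
have to_rev := fixes_walk_to_reverse _ _ _ out2 tr ntr Gg.
have of_rev v : fixes_walk_to (reverse Gamma) k g v -> fixes_walk_to Gamma k g v.
  exact: (fixes_walk_to_reverse (reverse Gamma) _ _ in2 tr' ntr' Gg').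
apply/funext => v.
suff [q [_ <- ->]] : fixes_walk_to Gamma k g v by [].
have fix0 : fixes_walk_to Gamma k g (p k) by exists p.
elim: (conn (p k) v) fix0 => // [x y [xy|yx]|x y z _ xy _ yz /xy /yz //].
- exact: fwd.
(* An arc traversed backwards is a forward step in the reverse digraph. *)
- by move=> /to_rev /(bwd _ y yx) /of_rev.
Qed.

(** The k-walks from [v] correspond to k-bit strings. Sending a string to an automorphism that
    carries a base walk to the encoded walk is a bijection onto the stabilizer: injective as the
    walk determines the bits, surjective by rigidity. *)
Lemma card_vertex_stabilizer (Gamma : digraph) (k : nat) :
  (forall v : Gamma, out_nbhd v #= `I_2) ->
  walk_transitive Gamma k ->
  (forall p g, Aut Gamma g -> walk Gamma k p ->
    (forall i, i <= k -> g (p i) = p i) -> g = id) ->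
  forall v : Gamma, vertex_stabilizer v #= `I_(2 ^ k).
Proof.
move=> out2 tr rigid v.
have [s sP] := choice (fun x => card_eq2_coding _ _ (out2 x)).
have s_inj x : injective (s x) by case: (sP x).
have s_arc x b : Defs.arc x (s x b).
  by have [_ /seteqP[_ sN]] := sP x; apply: sN; exists b.
have arc_s x y : Defs.arc x y -> exists b, s x b = y.
  by have [_ /seteqP[sN _]] := sP x; move=> /sN[b _ <-]; exists b.
pose path (t : k.-tuple bool) i := foldl s v (take i t).
have pathS t i : i < k -> path t i.+1 = s (path t i) (nth false t i).
  by move=> lt_ik; rewrite /path (take_nth false) ?size_tuple // foldl_rcons.
have path0 t : path t 0 = v by rewrite /path take0.
have path_walk t : walk Gamma k (path t) by move=> i lt_ik; rewrite pathS.
pose t0 := [tuple of nseq k false].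
have F_ex t : exists g,
    Aut Gamma g /\ forall i, i <= k -> g (path t0 i) = path t i.
  by have [g Gg gE] := tr _ _ (path_walk t0) (path_walk t); exists g.
have [F FP] := choice F_ex.
have F_inj : injective F.
  move=> t t' FE; apply: eq_from_tnth => i; rewrite !(tnth_nth false).
  have E j : j <= k -> path t j = path t' j.
    by move=> le_jk; rewrite -(FP t).2 // FE (FP t').2.
  by have := E _ (ltn_ord i); rewrite !pathS // E ?(ltnW (ltn_ord i)) // => /s_inj.
have F_surj : F @` setT = vertex_stabilizer v.
  apply/seteqP; split=> [_ [t _ <-]|g [Gg gv]].
    split; first exact: (FP t).1.
    by rewrite /act_vertex -{1}(path0 t0) (FP t).2.
  (* The bound [i < k] sits under the existential so that [choice] gives a total function; its
     values from [k] on are arbitrary. *)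
  have gw i : exists b, i < k -> s (g (path t0 i)) b = g (path t0 i.+1).
    have [lt_ik|//] := ltnP i k; last by exists true.
    have /arc_s[b bE] : Defs.arc (g (path t0 i)) (g (path t0 i.+1)).
      by apply/(Gg.2 _ _); exact: path_walk.
    by exists b.
  have [bit bitE] := choice gw.
  pose t := [tuple of mkseq bit k].
  exists t => //.
  have gE i : i <= k -> path t i = g (path t0 i).
    elim: i => [_|i IHi lt_ik]; first by rewrite !path0.
    by rewrite pathS // IHi ?(ltnW lt_ik) // -bitE // nth_mkseq.
  have [g' Gg' [gK g'K]] := Aut_inv _ _ Gg.
  (* Both [F t] and [g] carry the base walk to [path t], so [g' \o F t] fixes it pointwise. *)
  have /(congr1 (fun h x => g (h x))) : g' \o F t = id.
    apply: (rigid (path t0)) => //; first by apply: Aut_comp => //; exact: (FP t).1.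
    by move=> i le_ik; rewrite /= (FP t).2 // gE.
  by move=> /= E; apply/funext => x; have := congr1 (@^~ x) E; rewrite /= g'K.
rewrite -F_surj; apply: card_eq_trans (inj_card_eq _) _; first by move=> ? ? _ _ /F_inj.
by have := card_fintype (k.-tuple bool); rewrite card_tuple card_bool.
Qed.

Theorem proposition6 (Gamma : digraph)
  (Gamma_conn : digraph_connected Gamma)
  (Gamma_vt : vertex_transitive Gamma)
  (in_valency2 : forall v : Gamma, in_nbhd v #= `I_2)
  (out_valency2 : forall v : Gamma, out_nbhd v #= `I_2) :
  (~ highly_arc_transitive Gamma ->
     exists k : nat,
       karc_regular Gamma k /\
       forall v : Gamma, vertex_stabilizer v #= `I_(2 ^ k)%N) /\
  ((forall v : Gamma, infinite_set (vertex_stabilizer v)) ->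
     highly_arc_transitive Gamma).
Proof.
have regular : ~ highly_arc_transitive Gamma -> exists k : nat,
    karc_regular Gamma k /\ forall v : Gamma, vertex_stabilizer v #= `I_(2 ^ k)%N.
  move=> /existsNP[n nhat].
  have tr0 : walk_transitive Gamma 0.
    move=> p q _ _; have [g Gg gE] := Gamma_vt (p 0) (q 0) I I.
    by exists g => // i; rewrite leqn0 => /eqP ->.
  (* Otherwise induction from vertex-transitivity, which is [tr0], would give transitivity on
     n-arcs, against [nhat]. *)
  have [k [tr ntr]] : exists k, walk_transitive Gamma k /\ ~ walk_transitive Gamma k.+1.
    apply: contrapT => no_k; apply: nhat; apply/karc_transitiveP.
    elim: n => // n tr; apply: contrapT => ntr.
    by apply: no_k; exists n.
  have rigid := fixed_walk_id _ _ Gamma_conn in_valency2 out_valency2 tr ntr.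
  exists k; split; last exact: card_vertex_stabilizer.
  split=> [|a aw]; first exact/karc_transitiveP.
  apply/seteqP; split=> [g [Gg ga]|_ ->]; last by split; [exact: Aut_id|].
  apply: rigid Gg (walk_karcs _ _ _ aw) _ => i _.
  by have := congr1 (@^~ (inord i)) ga.
split=> // inf; apply: contrapT => nhat.
have [k [_ card_stab]] := regular nhat.
(* [Gamma] may be empty; the arc [a] supplies a vertex whose stabilizer would be both finite and
   infinite. *)
apply: nhat => n a; suff : False by [].
by apply: (inf (a ord0)); apply/finite_setP; exists (2 ^ k)%N.
Qed.
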